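(* Let $\pi$ be a policy in a discounted MDP with $n$ states and discount factor $\gamma\in[0,1)$, with transition matrix $\mathcal{P}^\pi\in\mathbb{R}^{n\times n}$, reward vector $r^\pi\in\mathbb{R}^n$ and value function $V^\pi$. Let $\lambda_1,\dots,\lambda_n$ be the eigenvalues of $\mathcal{P}^\pi$ (with algebraic multiplicity) sorted in decreasing order of magnitude with ties broken arbitrarily. Let $1\le s\le n$ and let $E_s=\sum_{i=1}^s\lambda_i u_iv_i^\top$ be a rank-$s$ deflation matrix of $\mathcal{P}^\pi$ (of Hotelling, Wielandt, or Schur type). Let $0<\alpha\le 1$, let $V^0\in\mathbb{R}^n$ be arbitrary, and for $k=0,1,\dots$ define the DDVI iteration $$W^{k+1}=(1-\alpha)V^k+\alpha r^\pi+\alpha\gamma\Big(\mathcal{P}^\pi-\sum_{i=1}^s\lambda_iu_iv_i^\top\Big)V^k,\qquad V^{k+1}=\Big(I+\sum_{i=1}^s\frac{\alpha\gamma\lambda_i}{1-\alpha\gamma\lambda_i}u_iv_i^\top\Big)W^{k+1}.$$ Then, as $k\to\infty$, $$\|V^k-V^\pi\|=\tilde O\big(|\lambda|^k\,\|V^0-V^\pi\|\big),\qquad \lambda=\max_{1\le i\le s,\ s+1\le j\le n}\Big\{\Big|\frac{1-\alpha}{1-\alpha\gamma\lambda_i}\Big|,\ \big|1-\alpha+\alpha\gamma\lambda_j\big|\Big\}.$$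
   Context: A discounted MDP here has a finite state space $\mathcal{X}$ with $|\mathcal{X}|=n$, an action space $\mathcal{A}$, a transition kernel $\mathcal{P}(\cdot\mid x,a)$, expected rewards $r(x,a)$ and discount factor $\gamma\in[0,1)$. A policy $\pi$ maps states to distributions over actions; $r^\pi(x)=\mathbf{E}_{a\sim\pi(\cdot\mid x)}[r(x,a)]$, and $\mathcal{P}^\pi$ is the (row-)stochastic matrix $\mathcal{P}^\pi(x'\mid x)=\sum_a\pi(a\mid x)\mathcal{P}(x'\mid x,a)$ (an integral if actions are continuous). The value function $V^\pi$ is the unique solution of $(I-\gamma\mathcal{P}^\pi)V^\pi=r^\pi$. Throughout, $u^\top$ denotes the conjugate transpose of $u\in\mathbb{C}^n$, and $\|\cdot\|$ is the $\ell^\infty$ norm (iterates may be in $\mathbb{C}^n$). Rank-$s$ deflation matrix of $\mathcal{P}^\pi$: a matrix $E_s=\sum_{i=1}^s\lambda_iu_iv_i^\top$ such that one of the following holds. (Hotelling) There exist $s$ linearly independent right eigenvectors corresponding to $\lambda_1,\dots,\lambda_s$; $u_1,\dots,u_s$ are such right eigenvectors ($\mathcal{P}^\pi u_i=\lambda_iu_i$) and $v_1,\dots,v_s$ are corresponding left eigenvectors ($v_i^\top\mathcal{P}^\pi=\lambda_iv_i^\top$), scaled so that $u_i^\top v_i=1$ and $u_i^\top v_j=0$ for $1\le i\ne j\le s$. (Wielandt) $u_1,\dots,u_s$ are linearly independent right eigenvectors corresponding to $\lambda_1,\dots,\lambda_s$, and $v_1,\dots,v_s$ are any vectors (not necessarily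 left eigenvectors) with $u_i^\top v_i=1$ and $u_i^\top v_j=0$ for $1\le i\neq j\le s$. (Schur) $v_i=u_i$, where $u_1,\dots,u_s$ are the first $s$ columns of a unitary matrix $U$ in a Schur decomposition $\mathcal{P}^\pi=URU^\top$, with $R$ upper triangular and $R_{ii}=\lambda_i$ for $i=1,\dots,n$. If $s=n$, the family indexed by $j$ in the definition of $\lambda$ is empty and the maximum is over the remaining terms only. The notation $\|V^k-V^\pi\|=\tilde O(|\lambda|^k\|V^0-V^\pi\|)$ as $k\to\infty$ means: for every $\epsilon>0$, $\|V^k-V^\pi\|=O(|\lambda+\epsilon|^k\|V^0-V^\pi\|)$ as $k\to\infty$, i.e. there are constants $C,K$ (not depending on $k$) with $\|V^k-V^\pi\|\le C|\lambda+\epsilon|^k\|V^0-V^\pi\|$ for all $k\ge K$. *)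

(* Defs.v *)
From HB Require Import structures.
From mathcomp Require Import all_boot all_order all_algebra.
From mathcomp Require Import all_classical all_reals all_analysis.
From mathcomp Require Import complex.

Set Implicit Arguments.
Unset Strict Implicit.
Unset Printing Implicit Defensive.

Import Order.TTheory GRing.Theory Num.Theory.
Import numFieldNormedType.Exports.

Local Open Scope classical_set_scope.
Local Open Scope ring_scope.
Local Open Scope sesquilinear_scope.
Local Open Scope complex_scope.

(* The action space is an arbitrary measurable space, so that continuous
   actions are allowed; for a countable action set equipped with the discrete
   sigma-algebra the integrals below are the usual sums over actions.  The
   reward function is unconstrained here: its integrability depends on the
   policy, see [integrable_reward]. *)
Record mdp (R : realType) (X : finType) (d : measure_display)
    (A : measurableType d) := MDP {
  trans : X -> A -> X -> R;
  reward : X -> A -> R;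
  discount : R;
  trans_ge0 : forall x a x', 0 <= trans x a x';
  trans_sum1 : forall x a, \sum_(x' : X) trans x a x' = 1;
  trans_measurable : forall x x',
    measurable_fun [set: A] (fun a => trans x a x');
  discount_ge0 : 0 <= discount;
  discount_lt1 : discount < 1 }.

Section Policy.
Context (R : realType) (X : finType) (d : measure_display)
  (A : measurableType d) (M : mdp R X A) (pi : X -> probability A R).

Definition integrable_reward : Prop :=
  forall x, (pi x).-integrable [set: A] (fun a => (reward M x a)%:E).

(* Matrices over the states are indexed through the enumeration of [X]. *)
Definition policy_trans : 'M[R]_#|X| := \matrix_(i, j)
  \int[pi (enum_val i)]_(a in [set: A]) trans M (enum_val i) a (enum_val j).

Definition policy_reward : 'cV[R]_#|X| := \col_i
  \int[pi (enum_val i)]_(a in [set: A]) reward M (enum_val i) a.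

Definition is_value_function (V : 'cV[R]_#|X|) : Prop :=
  (1%:M - discount M *: policy_trans) *m V = policy_reward.

Lemma policy_trans_ge0 i j : 0 <= policy_trans i j.
Proof.
by rewrite mxE /Rintegral fine_ge0// integral_ge0// => a _;
  rewrite lee_fin trans_ge0.
Qed.

Lemma trans_integrable x x' :
  (pi x).-integrable [set: A] (fun a => (trans M x a x')%:E).
Proof.
apply: (@measurable_bounded_integrable _ _ _ (pi x) (fun a => trans M x a x')) => //.
- apply: (@le_lt_trans _ _ 1%E); [exact: probability_le1 | exact: ltry].
- exact: trans_measurable.
- exists 1; split => // r r1 a _ /=.
  rewrite ger0_norm ?trans_ge0//.
  apply: le_trans (ltW r1).
  rewrite -(trans_sum1 M x a) (bigD1 x')//= lerDl.
  by apply: sumr_ge0 => ? _; exact: trans_ge0.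
Qed.

Lemma policy_trans_row_sum i : \sum_j policy_trans i j = 1.
Proof.
under eq_bigr do rewrite mxE.
have fin j : (\int[pi (enum_val i)]_(a in [set: A])
    (trans M (enum_val i) a (enum_val j))%:E)%E \is a fin_num.
  exact/integrable_fin_num/trans_integrable.
apply: EFin_inj; rewrite -sumEFin.
under eq_bigr => j _ do rewrite /Rintegral fineK//.
rewrite -integral_sum//; last by move=> j; exact: trans_integrable.
rewrite (eq_integral (fun=> 1%E)) ?integral_cst//.
  by rewrite mul1e; exact: probability_setT.
move=> a _; rewrite sumEFin; congr EFin.
rewrite -[RHS](trans_sum1 M (enum_val i) a).
by rewrite [RHS](reindex (@enum_val X predT))//; exact/onW_bij/enum_val_bij.
Qed.

Lemma value_function_exists_unique : exists! V, is_value_function V.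
Proof.
have unitA : 1%:M - discount M *: policy_trans \in unitmx.
  rewrite -unitmx_tr -row_free_unit -kermx_eq0; apply/eqP/row_matrixP => k.
  rewrite row0; set w := row k _.
  have : (1%:M - discount M *: policy_trans) *m w^T = 0.
    apply: trmx_inj; rewrite trmx_mul trmxK trmx0.
    by apply/sub_kermxP; exact: row_sub.
  rewrite mulmxBl mul1mx -scalemxAl => /eqP; rewrite subr_eq0 => /eqP wE.
  apply: trmx_inj; rewrite trmx0; move: (w^T) wE => {k}w wE.
  apply/matrixP => i j; rewrite ord1 mxE.
  case: (@arg_maxP _ _ _ i xpredT (fun l => `|w l 0|)) => // m _ mmax.
  have : `|w m 0| <= discount M * `|w m 0|.
    rewrite {1}wE !mxE normrM ger0_norm ?discount_ge0//.
    rewrite ler_wpM2l ?discount_ge0//; apply: (le_trans (ler_norm_sum _ _ _)).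
    rewrite -[leRHS]mul1r -(policy_trans_row_sum m) mulr_suml.
    apply: ler_sum => l _; rewrite normrM (ger0_norm (policy_trans_ge0 _ _)).
    by rewrite ler_wpM2l ?policy_trans_ge0//; exact: mmax.
  rewrite -subr_ge0 -[X in _ - X]mul1r -mulrBl => h.
  have : `|w m 0| <= 0.
    by rewrite -(nmulr_rge0 _ (_ : discount M - 1 < 0))// subr_lt0 discount_lt1.
  by move=> /(le_trans (mmax i isT)); rewrite normr_le0 => /eqP.
exists (invmx (1%:M - discount M *: policy_trans) *m policy_reward); split.
  by rewrite /is_value_function mulKVmx.
by move=> V <-; rewrite mulKmx.
Qed.
End Policy.

Section Deflation.
Context (R : realType) (n : nat).
Implicit Types (P : 'M[R[i]]_n) (lam : 'I_n -> R[i]).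

(* The order on [R[i]] is only partial, but moduli are real. *)
Definition is_sorted_spectrum P lam : Prop :=
  char_poly P = \prod_(i < n) ('X - (lam i)%:P) /\
  forall i j : 'I_n, (i <= j)%N -> `|lam j| <= `|lam i|.

Definition is_right_eigenvector P (l : R[i]) (u : 'cV[R[i]]_n) : Prop :=
  u != 0 /\ P *m u = l *: u.

Definition is_left_eigenvector P (l : R[i]) (v : 'cV[R[i]]_n) : Prop :=
  v != 0 /\ v^t* *m P = l *: v^t*.

Context (s : nat) (sn : (s <= n)%N).
Implicit Types (u v : 'I_s -> 'cV[R[i]]_n).

Definition biorthonormal u v : Prop :=
  forall i j, ((u i)^t* *m v j) 0 0 = (i == j)%:R.

Definition hotelling P lam u v : Prop :=
  [/\ free [tuple u i | i < s],
      forall i, is_right_eigenvector P (lam (widen_ord sn i)) (u i),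
      forall i, is_left_eigenvector P (lam (widen_ord sn i)) (v i) &
      biorthonormal u v].

Definition wielandt P lam u v : Prop :=
  [/\ free [tuple u i | i < s],
      forall i, is_right_eigenvector P (lam (widen_ord sn i)) (u i) &
      biorthonormal u v].

(* [is_trig_mx] means lower triangular, hence the transpose. *)
Definition schur P lam u v : Prop :=
  (forall i, v i = u i) /\
  exists U T : 'M[R[i]]_n,
    [/\ U \is unitarymx, is_trig_mx T^T, P = U *m T *m U^t*,
        forall i, T i i = lam i &
        forall i, u i = col (widen_ord sn i) U].

Definition is_deflation P lam u v : Prop :=
  [\/ hotelling P lam u v, wielandt P lam u v | schur P lam u v].

Definition deflation_mx lam u v : 'M[R[i]]_n :=
  \sum_(i < s) lam (widen_ord sn i) *: (u i *m (v i)^t*).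

End Deflation.

Section DDVI.
Context (R : realType) (n : nat).

Definition complex_mx (m p : nat) (B : 'M[R]_(m, p)) : 'M[R[i]]_(m, p) :=
  map_mx (real_complex R) B.

Definition supnorm (w : 'cV[R[i]]_n) : R :=
  \big[Num.max/0]_(i < n) Normc.normc (w i 0).

Context (s : nat) (sn : (s <= n)%N) (P : 'M[R]_n) (r : 'cV[R]_n) (gamma : R).
Context (lam : 'I_n -> R[i]) (u v : 'I_s -> 'cV[R[i]]_n) (alpha : R).

Definition ddvi_W (V : 'cV[R[i]]_n) : 'cV[R[i]]_n :=
  (1 - alpha)%:C *: V + alpha%:C *: complex_mx r
  + (alpha * gamma)%:C *: ((complex_mx P - deflation_mx sn lam u v) *m V).

Definition ddvi_correction : 'M[R[i]]_n :=
  1%:M + \sum_(i < s)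
    ((alpha * gamma)%:C * lam (widen_ord sn i)
       / (1 - (alpha * gamma)%:C * lam (widen_ord sn i)))
    *: (u i *m (v i)^t*).

Definition ddvi (V0 : 'cV[R]_n) (k : nat) : 'cV[R[i]]_n :=
  iter k (fun V => ddvi_correction *m ddvi_W V) (complex_mx V0).

(* All terms are nonnegative, so the default value 0 of [\big[Num.max/0]] only
   matters when a family is empty. *)
Definition ddvi_rate : R :=
  Num.max
    (\big[Num.max/0]_(i < s)
       Normc.normc ((1 - alpha)%:C
                    / (1 - (alpha * gamma)%:C * lam (widen_ord sn i))))
    (\big[Num.max/0]_(j < n | (s <= j)%N)
       Normc.normc ((1 - alpha)%:C + (alpha * gamma)%:C * lam j)).

End DDVI.

(* Main.v *)
Require Import Defs.
From HB Require Import structures.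
From mathcomp Require Import all_boot all_order all_algebra.
From mathcomp Require Import all_classical all_reals all_analysis.
From mathcomp Require Import complex ring.

Set Implicit Arguments.
Unset Strict Implicit.
Unset Printing Implicit Defensive.

Import Order.TTheory GRing.Theory Num.Theory.
Import numFieldNormedType.Exports.

Local Open Scope ring_scope.
Local Open Scope complex_scope.

(* The error [V^k - V^pi] is multiplied at each step by a fixed matrix [M].  All
   three kinds of deflation give [A = (u_1 ... u_s)], [B = (v_1 ... v_s)^*] and
   an upper triangular [T] with diagonal [lam_1, ..., lam_s] such that [B A = 1]
   and [P A = A T].  Hence [M] preserves the span of the [u_i], acts on it as a
   triangular matrix with eigenvalues [(1 - alpha) / (1 - alpha gamma lam_i)],
   and acts on the quotient as [1 - alpha + alpha gamma P], whose eigenvalues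
   there come from [lam_j], [j > s].  Thus every root of the characteristic
   polynomial of [M] has modulus at most the rate [lambda], and Cayley-Hamilton
   turns this into a bound on the powers of [M]. *)

(** * Determinants and characteristic polynomials under an intertwining relation *)

Lemma det_block_mx1 (R : comPzRingType) (n s : nat) (H : 'M[R]_n)
    (A : 'M[R]_(n, s)) (Y : 'M[R]_(s, n)) :
  \det (block_mx H A Y 1%:M) = \det (H - A *m Y).
Proof.
rewrite -[LHS]mulr1.
have {2}<- : \det (block_mx 1%:M 0 (- Y) 1%:M : 'M[R]_(n + s)) = 1.
  by rewrite det_lblock !det1 mulr1.
rewrite -det_mulmx mulmx_block !mulmx1 mulmx0 add0r mulmxN mul1mx addrN.
by rewrite mulmx0 add0r det_ublock det1 mulr1.
Qed.

(* Multiply [block_mx H A Y 1] on the right by [block_mx 1 (- A) 0 T]. *)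
Lemma det_sub_mul_intertwine (R : comPzRingType) (n s : nat) (H : 'M[R]_n)
    (A : 'M[R]_(n, s)) (Y : 'M[R]_(s, n)) (T : 'M[R]_s) :
  H *m A = A *m T ->
  \det (H - A *m Y) * \det T = \det H * \det (T - Y *m A).
Proof.
move=> HA; rewrite -det_block_mx1.
have -> : \det T = \det (block_mx 1%:M (- A) 0 T) by rewrite det_ublock det1 mul1r.
rewrite -det_mulmx mulmx_block !mulmx1 !mulmx0 !addr0 mul1mx !mulmxN HA addNr.
by rewrite det_lblock addrC.
Qed.

(** The determinant identity over polynomials, with ['X - H] and ['X - T] for [H] and [T]. It
    compares spectra without completing the columns of [A] to a basis. *)
Lemma char_poly_add_mul_intertwine (R : comNzRingType) (n s : nat) (H : 'M[R]_n)
    (A : 'M[R]_(n, s)) (Y : 'M[R]_(s, n)) (T : 'M[R]_s) :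
  H *m A = A *m T ->
  char_poly (H + A *m Y) * char_poly T = char_poly H * char_poly (T + Y *m A).
Proof.
move=> HA; rewrite /char_poly /char_poly_mx !map_mxD !map_mxM !opprD !addrA.
apply: det_sub_mul_intertwine.
by rewrite mulmxBl mulmxBr -!map_mxM HA mul_scalar_mx mul_mx_scalar.
Qed.

(** For [b != 0], substitute [(X - a) / b] in [char_poly P] and multiply by [b ^+ n]; for [b = 0]
    the matrix is scalar. *)
Lemma char_poly_affine (F : fieldType) (n : nat) (P : 'M[F]_n) (a b : F)
    (lam : 'I_n -> F) :
  char_poly P = \prod_i ('X - (lam i)%:P) ->
  char_poly (a%:M + b *: P) = \prod_i ('X - (a + b * lam i)%:P).
Proof.
move=> charP; have [->|b0] := eqVneq b 0.
  rewrite scale0r addr0 char_poly_trig ?scalar_mx_is_trig//.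
  by apply: eq_bigr => i _; rewrite mxE eqxx mul0r addr0.
pose q : {poly F} := b^-1 *: ('X - a%:P).
have bq : b *: q = 'X - a%:P by rewrite scalerA divff// scale1r.
have -> : char_poly (a%:M + b *: P) = b ^+ n *: (char_poly P \Po q).
  rewrite -mul_polyC rmorphXn /char_poly /= -det_map_mx -detZ; congr (\det _).
  apply/matrixP => i j; rewrite !mxE rmorphB /= rmorphMn /= comp_polyX comp_polyC.
  rewrite mulrBr mulrnAr mul_polyC bq polyCD polyCM opprD addrA; congr (_ - _).
  by case: (i == j); rewrite ?mulr1n ?mulr0n ?subr0.
rewrite charP rmorph_prod /= -mul_polyC rmorphXn /=.
rewrite -[n in b%:P ^+ n]card_ord -prodr_const -big_split /=.
apply: eq_bigr => i _; rewrite rmorphB /= comp_polyX comp_polyC mulrBr mul_polyC.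
by rewrite bq polyCD polyCM opprD addrA.
Qed.

(** * Sup norm and growth of matrix powers *)

Section Supnorm.
Context (R : realType) (n : nat).
Implicit Types (w : 'cV[R[i]]_n).

Lemma normc_ge0 (z : R[i]) : 0 <= Normc.normc z.
Proof. by rewrite -lecR; exact: (normr_ge0 z). Qed.

Lemma supnorm_leP w (c : R) : 0 <= c ->
  reflect (forall i, Normc.normc (w i 0) <= c) (supnorm w <= c).
Proof.
move=> c0; apply: (iffP idP) => [wc i|wc]; last by apply: bigmax_le => // i _.
by apply: le_trans wc; exact: (le_bigmax_cond _ (fun i => Normc.normc (w i 0))).
Qed.

Lemma supnorm_ge0 w : 0 <= supnorm w.
Proof. exact: bigmax_ge_id. Qed.

Lemma normc_le_supnorm w i : Normc.normc (w i 0) <= supnorm w.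
Proof. by move: i; apply/supnorm_leP; rewrite ?supnorm_ge0. Qed.

Lemma supnorm0 : supnorm (0 : 'cV[R[i]]_n) = 0.
Proof.
apply/le_anti; rewrite supnorm_ge0 andbT.
by apply/supnorm_leP => // i; rewrite mxE Normc.normc0.
Qed.

Lemma supnorm_eq0 w : (supnorm w == 0) = (w == 0).
Proof.
apply/eqP/eqP => [w0|->]; last exact: supnorm0.
apply/colP => i; rewrite mxE; apply: Normc.eq0_normc.
by apply/le_anti; rewrite normc_ge0 andbT -w0 normc_le_supnorm.
Qed.

Lemma ler_supnorm_scaleD (z : R[i]) w1 w2 :
  supnorm (z *: w1 + w2) <= Normc.normc z * supnorm w1 + supnorm w2.
Proof.
apply/supnorm_leP => [|i].
  by rewrite addr_ge0 ?mulr_ge0 ?normc_ge0 ?supnorm_ge0.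
rewrite !mxE; apply: (le_trans (le_normcD _ _)).
rewrite Normc.normcM lerD ?normc_le_supnorm// ler_wpM2l ?normc_ge0//.
exact: normc_le_supnorm.
Qed.

End Supnorm.

(* Removing a factor [M - mu] at a time: with [w' = (M - mu) w], the recurrence
   [M^(k+1) w = mu M^k w + M^k w'] keeps [M^k w] of order [rho^k] as soon as
   [M^k w'] is and [|mu| < rho]. *)
Lemma power_growth (R : realType) (n : nat) (M : 'M[R[i]]_n.+1)
    (l : seq R[i]) (rho : R) (w : 'cV[R[i]]_n.+1) :
  {in l, forall mu, Normc.normc mu < rho} ->
  horner_mx M (\prod_(mu <- l) ('X - mu%:P)) *m w = 0 ->
  exists C, forall k, supnorm (M ^+ k *m w) <= C * rho ^+ k.
Proof.
elim: l w => [|mu l IH] w lrho.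
  rewrite big_nil rmorph1 mul1mx => ->; exists 0 => k.
  by rewrite mulmx0 supnorm0 mul0r.
have mu_rho : Normc.normc mu < rho by apply: lrho; rewrite mem_head.
have rho_gt0 : 0 < rho by apply: le_lt_trans mu_rho; exact: normc_ge0.
rewrite big_cons mulrC rmorphM /= -mulmxA => /IH[nu nul|C hC].
  by apply: lrho; rewrite in_cons nul orbT.
(* The first entry covers [k = 0]; the second gives [|mu| C' + C <= rho C'], which closes the
   induction. *)
pose C' := Num.max (supnorm w) (C / (rho - Normc.normc mu)).
exists C'; elim=> [|k IHk]; first by rewrite expr0 mul1mx mulr1 le_max lexx.
have -> : M ^+ k.+1 *m w = mu *: (M ^+ k *m w)
    + M ^+ k *m (horner_mx M ('X - mu%:P) *m w).
  rewrite rmorphB /= horner_mx_X horner_mx_C mulmxBl mulmxBr mul_scalar_mx.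
  by rewrite -scalemxAr addrC subrK mulmxA exprSr.
apply: (le_trans (ler_supnorm_scaleD _ _ _)).
apply: (le_trans (lerD (ler_wpM2l (normc_ge0 _) IHk) (hC k))).
rewrite exprS !mulrA -mulrDl ler_wpM2r ?exprn_ge0 ?(ltW rho_gt0)//.
rewrite -lerBrDl [_ * C']mulrC -mulrBr -ler_pdivrMr ?subr_gt0//.
by rewrite le_max lexx orbT.
Qed.

(** For a row eigenvector [x], the sum of the [|x 0 j|] cannot grow under [x *m P], because the rows
    of [P] sum to 1. *)
Lemma stochastic_eigenvalue_le1 (R : realType) (n : nat) (P : 'M[R]_n) (l : R[i]) :
  (forall i j, 0 <= P i j) -> (forall i, \sum_j P i j = 1) ->
  root (char_poly (complex_mx P)) l -> Normc.normc l <= 1.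
Proof.
move=> P0 P1; rewrite -eigenvalue_root_char => /eigenvalueP[x xP x0].
rewrite -lecR -[leLHS]/`|l|.
have S0 : 0 < \sum_j `|x 0 j|.
  rewrite lt_def sumr_ge0 ?andbT//; apply: contra x0 => /eqP /psumr_eq0P z.
  by apply/eqP/rowP => j; rewrite mxE; apply/normr0_eq0/z.
rewrite -(ler_pM2r S0) mul1r mulr_sumr.
have -> : \sum_j `|x 0 j| = \sum_j \sum_i `|x 0 j| * (P j i)%:C.
  by apply: eq_bigr => j _; rewrite -mulr_sumr -rmorph_sum /= P1 mulr1.
rewrite exchange_big /=; apply: ler_sum => j _.
have /rowP/(_ j) := xP; rewrite !mxE => xPj; rewrite -normrM -xPj.
apply: (le_trans (ler_norm_sum _ _ _)); apply: ler_sum => i _.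
by rewrite normrM mxE (@ger0_norm _ (P i j)%:C)// lecR.
Qed.

(** * A common form for the three kinds of deflation *)

Section Deflation.
Local Open Scope sesquilinear_scope.
Context (R : realType) (n s : nat) (sn : (s <= n)%N).
Implicit Types (P : 'M[R[i]]_n) (lam : 'I_n -> R[i]) (u v : 'I_s -> 'cV[R[i]]_n).

Definition right_mx u : 'M[R[i]]_(n, s) := \matrix_(i, j) u j i 0.
Definition left_mx v : 'M[R[i]]_(s, n) := \matrix_(i, j) (v i)^t* 0 j.

Lemma sum_scale_outer u v (c : 'I_s -> R[i]) :
  \sum_(i < s) c i *: (u i *m (v i)^t*)
    = right_mx u *m diag_mx (\row_i c i) *m left_mx v.
Proof.
apply/matrixP => x y; rewrite summxE mxE; apply: eq_bigr => k _.
by rewrite mul_mx_diag !mxE big_ord1 !mxE mulrA [c k * _]mulrC.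
Qed.

Lemma biorthonormal_mul u v : biorthonormal u v -> left_mx v *m right_mx u = 1%:M.
Proof.
move=> uv; apply/matrixP => i j; rewrite !mxE.
(* The hypothesis concerns [u_j^* v_i] and the product [v_i^* u_j], so conjugate. *)
have /(congr1 Num.conj) := uv j i; rewrite conjC_nat eq_sym => <-.
rewrite mxE rmorph_sum /=; apply: eq_bigr => k _.
by rewrite !mxE rmorphM /= conjCK mulrC.
Qed.

(** Hotelling is an instance of Wielandt, where [T] is diagonal. For Schur, [T] is the leading block
    of the triangular factor. *)
Lemma deflation_triangular P lam u v : is_deflation sn P lam u v ->
  left_mx v *m right_mx u = 1%:M /\
  exists T : 'M[R[i]]_s, [/\ P *m right_mx u = right_mx u *m T, is_trig_mx T^T
    & forall i, T i i = lam (widen_ord sn i)].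
Proof.
have wielandt_case : wielandt sn P lam u v ->
    left_mx v *m right_mx u = 1%:M /\
    exists T : 'M[R[i]]_s, [/\ P *m right_mx u = right_mx u *m T, is_trig_mx T^T
      & forall i, T i i = lam (widen_ord sn i)].
  move=> [_ Pu uv]; split; first exact: biorthonormal_mul.
  exists (diag_mx (\row_i lam (widen_ord sn i))); split.
  - apply/matrixP => x j; have [_ /colP/(_ x)] := Pu j.
    rewrite mul_mx_diag !mxE mulrC => <-.
    by apply: eq_bigr => k _; rewrite mxE.
  - by rewrite tr_diag_mx diag_mx_is_trig.
  - by move=> i; rewrite !mxE eqxx.
case=> [[uf Pu _ uv]|//|]; first exact: wielandt_case.
move=> [vu [U [T [Uu Ttrig PE Tl uU]]]].
have UU : U^t* *m U = 1%:M by apply: mulmx1C; exact/unitarymxP.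
split.
  apply: biorthonormal_mul => i j; rewrite vu !uU.
  have /matrixP/(_ (widen_ord sn i) (widen_ord sn j)) := UU.
  rewrite !mxE -val_eqE /= => <-.
  by apply: eq_bigr => k _; rewrite !mxE.
exists (mxsub (widen_ord sn) (widen_ord sn) T); split.
- have PU : P *m U = U *m T by rewrite PE -mulmxA UU mulmx1.
  apply/matrixP => x j; have /matrixP/(_ x (widen_ord sn j)) := PU.
  rewrite mxE => PUx; rewrite mxE.
  under eq_bigr do rewrite mxE uU mxE.
  (* Terms with [k >= s > j] vanish by triangularity, so only the first [s] columns of [U]
     remain. *)
  rewrite PUx mxE (bigID (fun k : 'I_n => (k < s)%N)) /= big_ord_narrow addrC big1.
    by rewrite add0r mxE; apply: eq_bigr => k _; rewrite !mxE uU mxE.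
  move=> k; rewrite -leqNgt => sk; have /is_trig_mxP := Ttrig.
  move=> /(_ (widen_ord sn j) k); rewrite mxE => ->; rewrite ?mulr0//.
  exact: leq_trans (ltn_ord j) sk.
- by apply/is_trig_mxP => i j ij; have /is_trig_mxP := Ttrig;
    move=> /(_ (widen_ord sn i) (widen_ord sn j) ij); rewrite !mxE.
- by move=> i; rewrite mxE.
Qed.

End Deflation.

(** * The error matrix and its spectrum *)

Section Iteration.
Context (R : realType) (n s : nat) (sn : (s <= n)%N).
Context (P : 'M[R]_n) (r Vpi : 'cV[R]_n) (gamma alpha : R).
Context (lam : 'I_n -> R[i]) (u v : 'I_s -> 'cV[R[i]]_n).
Context (uv_deflation : is_deflation sn (complex_mx P) lam u v).
Context (lam_resolvent : forall i, 1 - (alpha * gamma)%:C * lam i != 0).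

Let a : R[i] := (1 - alpha)%:C.
Let b : R[i] := (alpha * gamma)%:C.
Let lam_s i := lam (widen_ord sn i).
Let A := right_mx u.
Let B := left_mx v.
Let Lam := diag_mx (\row_i lam_s i).

(** The linear part of one DDVI step; the reward cancels in differences. *)
Definition ddvi_mx : 'M[R[i]]_n :=
  ddvi_correction sn gamma lam u v alpha *m
  ((1 - alpha)%:C%:M
   + (alpha * gamma)%:C *: (complex_mx P - deflation_mx sn lam u v)).

Lemma deflation_mxE : deflation_mx sn lam u v = A *m Lam *m B.
Proof. exact: sum_scale_outer. Qed.

Lemma ddvi_correctionE : ddvi_correction sn gamma lam u v alpha
  = 1%:M + A *m diag_mx (\row_i (b * lam_s i / (1 - b * lam_s i))) *m B.
Proof. by rewrite /ddvi_correction sum_scale_outer. Qed.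

(** At [Vpi] the first half-step is multiplication by [1 - b E_s], and [B *m A = 1] makes the
    correction its inverse. *)
Lemma ddvi_fixpoint : (1%:M - gamma *: P) *m Vpi = r ->
  ddvi_correction sn gamma lam u v alpha
    *m ddvi_W sn P r gamma lam u v alpha (complex_mx Vpi) = complex_mx Vpi.
Proof.
have [BA _] := deflation_triangular uv_deflation; rewrite -/A -/B in BA.
move=> rE; have -> : ddvi_W sn P r gamma lam u v alpha (complex_mx Vpi)
    = (1%:M - b *: (A *m Lam *m B)) *m complex_mx Vpi.
  rewrite /ddvi_W -rE deflation_mxE /complex_mx map_mxM map_mxB map_mx1 map_mxZ.
  rewrite !mulmxBl !mul1mx -!scalemxAl -/b !scalerBr scalerA -rmorphM /= -/b.
  rewrite rmorphB /= rmorph1 scalerBl scale1r.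
  by rewrite !subrKA.
rewrite ddvi_correctionE mulmxA; set c := diag_mx _.
suff -> : (1%:M + A *m c *m B) *m (1%:M - b *: (A *m Lam *m B)) = 1%:M.
  by rewrite mul1mx.
rewrite mulmxBr mulmx1 -scalemxAr mulmxDl mul1mx !mulmxA.
rewrite -[A *m c *m B *m A]mulmxA BA mulmx1.
rewrite -[A *m c *m Lam]mulmxA -mulmxDl -mulmxDr.
rewrite -addrA scalemxAl scalemxAr -mulmxBl -mulmxBr.
suff -> : c - b *: (Lam + c *m Lam) = 0 by rewrite mulmx0 mul0mx addr0.
rewrite /c mul_diag_mx; apply/matrixP => i j; rewrite !mxE.
case: eqP => [_|_]; last by rewrite !mulr0n mulr0 addr0 mulr0 subrr.
have := lam_resolvent (widen_ord sn i); rewrite -/b -/(lam_s i).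
by rewrite !mulr1n; move: b (lam_s i) => b' l di; field.
Qed.

Lemma ddvi_error V0 k : (1%:M - gamma *: P) *m Vpi = r ->
  ddvi sn P r gamma lam u v alpha V0 k - complex_mx Vpi
    = iter k (mulmx ddvi_mx) (complex_mx V0 - complex_mx Vpi).
Proof.
move=> rE; elim: k => //= k; rewrite -/(ddvi _ _ _ _ _ _ _ _ _ k).
set V := ddvi _ _ _ _ _ _ _ _ _ k => <-.
rewrite -{1}(ddvi_fixpoint rE) -mulmxBr /ddvi_mx -mulmxA; congr (_ *m _).
rewrite /ddvi_W [RHS]mulmxDl mul_scalar_mx -scalemxAl mulmxBr !scalerBr.
rewrite opprD addrACA; congr (_ + _).
by rewrite opprD addrACA subrr addr0.
Qed.

(* With [M = H + A Y] and [H = a + b P], the intertwining lemma replaces the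
   eigenvalues [a + b lam_i], [i <= s], of [H] by those of the triangular
   matrix [T'] of [M] on the span of the columns of [A]. *)
Lemma char_poly_ddvi_mx :
  char_poly (complex_mx P) = \prod_(i < n) ('X - (lam i)%:P) ->
  char_poly ddvi_mx =
    (\prod_(i < s) ('X - (a / (1 - b * lam (widen_ord sn i)))%:P))
    * \prod_(j < n | (s <= j)%N) ('X - (a + b * lam j)%:P).
Proof.
have [BA [T [PA Ttrig Tl]]] := deflation_triangular uv_deflation.
rewrite -/A -/B in BA PA => charP; set H := a%:M + b *: complex_mx P.
set N := a%:M + b *: (complex_mx P - deflation_mx sn lam u v).
set c := diag_mx (\row_i (b * lam_s i / (1 - b * lam_s i))).
(* Since [ddvi_mx = (1 + A c B) N] and [N = H - b A Lam B], both perturbations of [H] start with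
   [A]; [Y] collects the rest. *)
pose Y := c *m B *m N - b *: (Lam *m B).
(* [D = 1 + c]. As [T - Lam] has zero diagonal, [T'] has diagonal entries [a / (1 - b lam_i)]. *)
pose D := diag_mx (\row_i (1 - b * lam_s i)^-1).
pose T' := D *m (a%:M + b *: (T - Lam)).
have HA : H *m A = A *m (a%:M + b *: T).
  by rewrite mulmxDl mulmxDr -scalemxAl PA -scalemxAr mul_scalar_mx mul_mx_scalar.
have ME : ddvi_mx = H + A *m Y.
  rewrite /ddvi_mx -/a -/b -/N ddvi_correctionE -/c mulmxDl mul1mx mulmxBr.
  rewrite {1}/N deflation_mxE scalerBr -scalemxAr !mulmxA [in LHS]addrA -/H.
  by rewrite addrAC -addrA.
have NA : N *m A = A *m (a%:M + b *: (T - Lam)).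
  rewrite mulmxDl mulmxDr -scalemxAl -scalemxAr mulmxBl mulmxBr PA deflation_mxE.
  by rewrite mul_scalar_mx mul_mx_scalar -[_ *m B *m A]mulmxA BA mulmx1.
have YA : a%:M + b *: T + Y *m A = T'.
  rewrite mulmxBl -[c *m B *m N *m A]mulmxA NA mulmxA -[c *m B *m A]mulmxA BA mulmx1.
  rewrite -scalemxAl -[Lam *m B *m A]mulmxA BA mulmx1 addrCA -addrA -scalerBr.
  rewrite -{2}[_ + b *: _]mul1mx -mulmxDl; congr (_ *m _).
  apply/matrixP => i j; rewrite !mxE; case: eqP => // _; rewrite ?addr0//.
  have := lam_resolvent (widen_ord sn i); rewrite -/b -/(lam_s i).
  by rewrite !mulr1n; move: a b (lam_s i) => a' b' l di; field.
have trT' : is_trig_mx T'^T.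
  apply/is_trig_mxP => i j ij; rewrite mxE /T' mul_diag_mx !mxE.
  have /is_trig_mxP/(_ i j ij) := Ttrig; rewrite mxE => ->.
  by rewrite -val_eqE /= gtn_eqF// !mulr0n subrr mulr0 addr0 mulr0.
have trT'' : is_trig_mx (a%:M + b *: T)^T.
  apply/is_trig_mxP => i j ij; rewrite !mxE.
  have /is_trig_mxP/(_ i j ij) := Ttrig; rewrite mxE => ->.
  by rewrite -val_eqE /= gtn_eqF// !mulr0n mulr0 addr0.
have char_tr m (Z : 'M[R[i]]_m) : char_poly Z^T = char_poly Z.
  rewrite /char_poly -det_tr; congr (\det _).
  by apply/matrixP => i j; rewrite !mxE eq_sym.
have := char_poly_add_mul_intertwine Y HA.
rewrite -ME YA (char_poly_affine _ _ charP) -(char_tr _ T').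
rewrite -(char_tr _ (_ + _)) (char_poly_trig trT') (char_poly_trig trT'').
rewrite [X in _ = X * _](bigID (fun i : 'I_n => (i < s)%N)) /= big_ord_narrow.
have -> : \prod_(i < s) ('X - ((a%:M + b *: T)^T i i)%:P)
    = \prod_(i < s) ('X - (a + b * lam_s i)%:P).
  by apply: eq_bigr => i _; rewrite !mxE eqxx mulr1n Tl.
(* The factors ['X - (a + b lam_i)], [i < s], occur on both sides and are nonzero polynomials, so
   they cancel. *)
rewrite mulrC -mulrA => /mulfI ->.
  rewrite mulrC; congr (_ * _).
    apply: eq_bigr => i _; rewrite mxE /T' mul_diag_mx !mxE eqxx !mulr1n Tl subrr.
    by rewrite mulr0 addr0 mulrC.
  by apply: eq_bigl => j; rewrite -leqNgt.
by apply/prodf_neq0 => i _; rewrite polyXsubC_eq0.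
Qed.

End Iteration.

(** * From the spectrum to the convergence rate *)

(** By Cayley-Hamilton [power_growth] applies to every [w]. As [C] may depend on [w], a nonzero
    [supnorm w] can be divided into it. *)
Lemma iter_mulmx_growth (R : realType) (n : nat) (M : 'M[R[i]]_n)
    (l : seq R[i]) (rho : R) (w : 'cV[R[i]]_n) :
  char_poly M = \prod_(mu <- l) ('X - mu%:P) ->
  {in l, forall mu, Normc.normc mu < rho} ->
  exists C, forall k, supnorm (iter k (mulmx M) w) <= C * rho ^+ k * supnorm w.
Proof.
have [-> _ _|] := eqVneq w 0.
  exists 0 => k; have -> : iter k (mulmx M) 0 = 0 :> 'cV[R[i]]_n.
    by elim: k => //= k ->; rewrite mulmx0.
  by rewrite supnorm0 mulr0.
case: n => [|n] in M w *; first by rewrite flatmx0 eqxx.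
move=> w0 charM /(@power_growth _ _ M l rho w)[|C hC].
  by rewrite -charM Cayley_Hamilton mul0mx.
exists (C / supnorm w) => k; rewrite mulrAC divfK ?supnorm_eq0//.
apply: le_trans (hC k); rewrite le_eqVlt; apply/orP; left; apply/eqP.
congr supnorm; elim: k => [|k /= ->]; first by rewrite expr0 mul1mx.
by rewrite exprS mulmxA.
Qed.

Theorem theorem3p1 (R : realType) (X : finType) (d : measure_display)
    (A : measurableType d) (M : mdp R X A) (pi : X -> probability A R)
    (pi_reward : integrable_reward M pi)
    (Vpi : 'cV[R]_#|X|) (Vpi_value : is_value_function M pi Vpi)
    (lam : 'I_#|X| -> R[i])
    (lam_spectrum : is_sorted_spectrum (complex_mx (policy_trans M pi)) lam)
    (s : nat) (s_ge1 : (1 <= s)%N) (s_len : (s <= #|X|)%N)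
    (u v : 'I_s -> 'cV[R[i]]_#|X|)
    (uv_deflation :
      is_deflation s_len (complex_mx (policy_trans M pi)) lam u v)
    (alpha : R) (alpha_gt0 : 0 < alpha) (alpha_le1 : alpha <= 1)
    (V0 : 'cV[R]_#|X|) :
  let V := ddvi s_len (policy_trans M pi) (policy_reward M pi) (discount M)
             lam u v alpha V0 in
  let lambda := ddvi_rate s_len (discount M) lam alpha in
  forall eps : R, 0 < eps ->
  exists (C : R) (K : nat), forall k : nat, (K <= k)%N ->
    supnorm (V k - complex_mx Vpi)
      <= C * `|lambda + eps| ^+ k * supnorm (complex_mx V0 - complex_mx Vpi).
Proof.
move=> V lambda eps eps0; have [charP _] := lam_spectrum.
have lam_le1 j : Normc.normc (lam j) <= 1.
  apply: (stochastic_eigenvalue_le1 (policy_trans_ge0 M pi)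
    (policy_trans_row_sum M pi)).
  by rewrite charP (bigD1 j)//= rootM root_XsubC eqxx.
(* [alpha * gamma < 1] and [|lam j| <= 1] keep the denominators of the correction nonzero. *)
have resolvent j : 1 - (alpha * discount M)%:C * lam j != 0.
  have ag0 : 0 <= alpha * discount M by rewrite mulr_ge0 ?discount_ge0 ?ltW.
  have ag1 : alpha * discount M < 1.
    apply: le_lt_trans (discount_lt1 M).
    by rewrite ler_piMl ?discount_ge0.
  rewrite subr_eq0 eq_sym; apply/eqP => /(congr1 (@Normc.normc R)).
  rewrite Normc.normcM Normc.normc1 => h.
  have : Normc.normc (alpha * discount M)%:C * Normc.normc (lam j) < 1.
    have -> : Normc.normc (alpha * discount M)%:C = alpha * discount M.
      by rewrite /= expr0n /= addr0 sqrtr_sqr ger0_norm.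
    by apply: le_lt_trans ag1; rewrite ler_piMr.
  by rewrite h ltxx.
pose l :=
  [seq (1 - alpha)%:C / (1 - (alpha * discount M)%:C * lam (widen_ord s_len i))
     | i <- index_enum 'I_s]
  ++ [seq (1 - alpha)%:C + (alpha * discount M)%:C * lam j
     | j <- [seq j : 'I_#|X| <- index_enum 'I_#|X| | (s <= j)%N]].
(* The slack [eps] gives the strict bound that [power_growth] needs to absorb repeated roots. *)
have l_lt : {in l, forall mu, Normc.normc mu < lambda + eps}.
  suff l_le : {in l, forall mu, Normc.normc mu <= lambda}.
    by move=> mu /l_le mul; rewrite ltr_pwDr.
  move=> mu; rewrite mem_cat /lambda /ddvi_rate le_max.
  move=> /orP[] /mapP[j + ->]; last rewrite mem_filter => /andP[sj _].
    by move=> _; apply/orP; left; apply: le_bigmax_cond.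
  by apply/orP; right; apply: le_bigmax_cond.
have lambda0 : 0 <= lambda by rewrite le_max bigmax_ge_id.
have [|C hC] := iter_mulmx_growth (complex_mx V0 - complex_mx Vpi) _ l_lt
  (M := ddvi_mx s_len (policy_trans M pi) (discount M) alpha lam u v).
  rewrite (char_poly_ddvi_mx uv_deflation resolvent charP).
  by rewrite big_cat !big_map big_filter.
exists C, 0%N => k _; rewrite ger0_norm ?addr_ge0 ?(ltW eps0)//.
by rewrite /V (ddvi_error uv_deflation resolvent _ _ Vpi_value).
Qed.
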